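(* For every integer $k\ge 0$ and nonnegative integers $r_0=1,r_1,\ldots,r_k$ with $r_k>0$, there exists a connected graph $G$ such that $\mu_{\rm d}(G)=k$ and the dual visibility spectrum of $G$ is $(1,r_1,\ldots,r_k)$.
   Context: All graphs are finite, simple and connected. For a graph $G$ and $X\subseteq V(G)$, two vertices $x,y$ are $X$-visible if there is a shortest $x,y$-path in $G$ with no internal vertex in $X$. $X$ is a dual mutual-visibility set if any two vertices of $X$ are $X$-visible and any two vertices of $V(G)\setminus X$ are $X$-visible. $\mu_{\rm d}(G)$ is the maximum cardinality of a dual mutual-visibility set. The dual visibility spectrum of $G$ is the vector $(r_0,\ldots,r_k)$ with $k=\mu_{\rm d}(G)$, where $r_i$ is the number of distinct dual mutual-visibility sets of $G$ of cardinality $i$ (so $r_0=1$, the empty set). *)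

(* Defs.v *)
From mathcomp Require Import all_boot.

Set Implicit Arguments.
Unset Strict Implicit.
Unset Printing Implicit Defensive.

Record sgraph := SGraph {
  vert :> finType;
  adj : rel vert;
  adj_sym : symmetric adj;
  adj_irrefl : irreflexive adj
}.

(* The graph without vertices is not connected. *)
Definition connected_graph (G : sgraph) : Prop :=
  0 < #|G| /\ forall x y : G, connect (@adj G) x y.

Section Visibility.
Variable G : sgraph.
Implicit Types (x y : G) (p : seq G) (X : {set G}).

(* As in [path], the sequence p lists the vertices after the start x. *)
Definition walk x y p : bool := path (@adj G) x p && (last x p == y).

Definition shortest_path x y p : Prop :=
  walk x y p /\ forall q, walk x y q -> size p <= size q.

(* All vertices of x :: p except the first and the last one. *)
Definition internal x p : seq G := behead (belast x p).

Definition avoids X p : bool := all (fun z => z \notin X) p.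

Definition visible X x y : Prop :=
  exists2 p, shortest_path x y p & avoids X (internal x p).

(* Boolean form of [visible], needed to count sets; see [visibleP]. A shortest
   path repeats no vertex, so its length is less than the number of vertices. *)
Definition visibleb X x y : bool :=
  [exists n : 'I_#|G|, exists p : n.-tuple G,
    [&& walk x y p,
        [forall m : 'I_n, forall q : m.-tuple G, ~~ walk x y q]
      & avoids X (internal x p)]].

Lemma shortest_path_size x y p : shortest_path x y p -> size p < #|G|.
Proof.
case=> /andP[xp /eqP xpy] minp; move: xpy; case/shortenP: xp => p' xp' Up' _ p'y.
have wp' : walk x y p' by rewrite /walk xp' p'y eqxx.
apply: leq_ltn_trans (minp _ wp') _.
by have := card_uniqP Up' => /= <-; apply: max_card.
Qed.

Lemma visibleP X x y : reflect (visible X x y) (visibleb X x y).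
Proof.
apply: (iffP existsP) => [[n /existsP[p /and3P[wp /forallP minp av]]] | [p sp av]].
  exists p => //; split=> // q wq; rewrite size_tuple leqNgt; apply/negP => lt_qn.
  by have /forallP/(_ (in_tuple q)) := minp (Ordinal lt_qn); rewrite wq.
exists (Ordinal (shortest_path_size sp)); apply/existsP; exists (in_tuple p) => /=.
have [wp minp] := sp; rewrite wp av andbT /=.
apply/forallP => m; apply/forallP => q; apply/negP => /minp.
by rewrite size_tuple leqNgt ltn_ord.
Qed.

Definition dual_mutual_visibility X : bool :=
  [forall x in X, forall y in X, visibleb X x y] &&
  [forall x in ~: X, forall y in ~: X, visibleb X x y].

Lemma dual_mutual_visibilityP X :
  reflect ({in X &, forall x y, visible X x y} /\
           {in ~: X &, forall x y, visible X x y})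
          (dual_mutual_visibility X).
Proof.
have allP (A : {set G}) : reflect {in A &, forall x y, visible X x y}
    [forall x in A, forall y in A, visibleb X x y].
  apply: (iffP forall_inP) => [h x y xA yA | h x xA].
    by apply/visibleP; move/forall_inP: (h x xA); apply.
  by apply/forall_inP => y yA; apply/visibleP; apply: h.
by apply: (iffP andP) => -[/allP h1 /allP h2].
Qed.

(* On a connected graph the empty set is a dual mutual-visibility set, so the
   default value 0 of an empty maximum plays no role there. *)
Definition mu_d : nat := \max_(X : {set G} | dual_mutual_visibility X) #|X|.

Definition num_dual_sets (i : nat) : nat :=
  #|[set X : {set G} | dual_mutual_visibility X & #|X| == i]|.

Definition dual_visibility_spectrum : mu_d.+1.-tuple nat :=
  [tuple num_dual_sets i | i < mu_d.+1].

End Visibility.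

(* Main.v *)
(** A set X is dual only if deleting it preserves distances among the other
    vertices. Hence a vertex with three pairwise nonadjacent neighbors that have
    no other common neighbor lies in no dual set: two of the three would be on
    the same side of X, invisible to each other. All vertices of a Petersen
    graph are of this kind, so gluing a copy of it at a vertex excludes that
    vertex from every dual set.

    Take disjoint cliques ("classes") of the prescribed sizes. For every set e of
    clique vertices add two hubs adjacent exactly to e, and join any two hubs by
    a path of length 2 through a new link vertex, except the two hubs of a set e
    that meets several classes. Glue a Petersen graph at each hub and link.
    A dual set X then consists of clique vertices; it lies in one class, since
    otherwise X contains all common neighbors of its own two hubs; and if it
    contains a but not b of the same class, then the hubs of {a} are invisible
    from b. Conversely a class is dual, because the neighbors outside it of its
    members are hubs, which are pairwise at distance at most 2 without it. *)

Require Import Defs.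
From mathcomp Require Import all_boot.

Set Implicit Arguments.
Unset Strict Implicit.
Unset Printing Implicit Defensive.

(** * Criteria for visibility and invisibility *)

Section VisibilityCriteria.
Variable G : sgraph.
Implicit Types (x y z u v : G) (p q : seq G) (X : {set G}).

Lemma walk_shortest x y p : walk x y p -> exists q, shortest_path x y q.
Proof.
have [n] := ubnP (size p); elim: n p => // n IHn p /ltnSE le_pn wp.
have [/existsP[m /existsP[q wq]] | noq] :=
  boolP [exists m : 'I_(size p), exists q : m.-tuple G, walk x y q].
  by apply: (IHn q) => //; apply: leq_trans le_pn; rewrite size_tuple.
exists p; split=> // q wq; rewrite leqNgt; apply: contra noq => lt_qp.
by apply/existsP; exists (Ordinal lt_qp); apply/existsP; exists (in_tuple q).
Qed.

Lemma visible_refl X x : visible X x x.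
Proof. by exists [::] => //; split=> //; rewrite /walk /= eqxx. Qed.

Lemma adj_visible X x y : adj x y -> visible X x y.
Proof.
move=> xy; exists [:: y] => //; split; first by rewrite /walk /= xy eqxx.
by case=> [|//] /andP[_ /eqP /= eq_xy]; rewrite eq_xy adj_irrefl in xy.
Qed.

(** The vertex [z] puts [x] and [y] at distance exactly 2, so the internal vertex of any shortest
    path is a common neighbor, hence in [X]. *)
Lemma common_neighbor_blocked X x y z :
    x != y -> ~~ adj x y -> adj x z -> adj z y ->
    (forall t, adj x t -> adj y t -> t \in X) ->
  ~ visible X x y.
Proof.
move=> xNy Axy xz zy blocked [p [/andP[xp /eqP p_y] minp]].
have /minp : walk x y [:: z; y] by rewrite /walk /= xz zy eqxx.
case: p xp p_y {minp} => [_ /= exy|t [|s [|//]]] /=; first by rewrite exy eqxx in xNy.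
  by rewrite andbT => xt ety; rewrite -ety xt in Axy.
case/and3P=> xt ts _ ety _; rewrite ety in ts.
by rewrite /avoids /internal /= andbT blocked // adj_sym.
Qed.

Lemma dual_outside_3star X x n1 n2 n3 :
    (forall i j, i \in [:: n1; n2; n3] -> j \in [:: n1; n2; n3] -> i != j ->
       ~~ adj i j /\ forall t, adj i t -> adj j t -> t = x) ->
    uniq [:: n1; n2; n3] -> all (adj x) [:: n1; n2; n3] ->
  dual_mutual_visibility X -> x \notin X.
Proof.
move=> star Un /allP An /dual_mutual_visibilityP[visX visCX].
apply/negP => xX.
have same i j : i \in [:: n1; n2; n3] -> j \in [:: n1; n2; n3] -> i != j ->
    (i \in X) <> (j \in X).
  move=> iN jN iNj eij; have [Aij uniq_t] := star i j iN jN iNj.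
  have nvis : ~ visible X i j.
    apply: (common_neighbor_blocked iNj Aij _ (An j jN)); first by rewrite adj_sym An.
    by move=> t it jt; rewrite (uniq_t t it jt).
  case iX : (i \in X); first by apply/nvis/visX; rewrite -?eij.
  by apply/nvis/visCX; rewrite inE -?eij iX.
move: Un; rewrite /= !inE negb_or andbT => /andP[/andP[n12 n13] n23].
have := same n1 n2; have := same n1 n3; have := same n2 n3.
rewrite !inE !eqxx ?orbT n12 n13 n23.
move=> /(_ isT isT isT) + /(_ isT isT isT) + /(_ isT isT isT).
by case: (n1 \in X); case: (n2 \in X); case: (n3 \in X).
Qed.

(* The detour replacing an excursion into X has length at most 2, the least
   possible length of such an excursion. *)
Lemma detour_visible X x y :
    (forall u v a b, a \in X -> b \in X -> u \notin X -> v \notin X ->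
       adj u a -> adj b v ->
       u = v \/ exists2 z, z \notin X & adj u z /\ adj z v) ->
    x \notin X -> y \notin X -> connect (@adj G) x y ->
  visible X x y.
Proof.
move=> detour xX yX /connectP[p0 xp0 def_y].
have /walk_shortest[p [wp minp]] : walk x y p0 by rewrite /walk xp0 def_y eqxx.
(* In the second half the walk is inside [X]: it entered at [a], coming from [u]. The extra 1 in the
   bound is paid by the walk from [u] to [z], which has at least one edge. *)
have key q z : walk z y q ->
    (z \notin X -> exists r, [/\ walk z y r, size r <= size q & avoids X r]) /\
    (z \in X -> forall u a, a \in X -> u \notin X -> adj u a ->
       exists r, [/\ walk u y r, size r <= (size q).+1 & avoids X r]).
  elim: q z => [|t q IHq] z.
    case/andP=> _ /eqP /= ->; split=> [_|]; last by rewrite (negPf yX).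
    by exists [::]; rewrite /walk /= eqxx.
  case/andP=> /= /andP[zt tq] qy.
  have [|IHout IHin] := IHq t; first by rewrite /walk tq.
  split=> [zX | zX u a aX uX ua].
    have [tX | tX] := boolP (t \in X); first exact: (IHin tX z t tX zX zt).
    have [r [/andP[tr ry] le_r rX]] := IHout tX.
    by exists (t :: r); rewrite /walk /= zt tr ry tX.
  have [tX | tX] := boolP (t \in X).
    have [r [wr le_r rX]] := IHin tX u a aX uX ua.
    by exists r; split=> //; apply: leq_trans le_r _.
  have [r [/andP[tr ry] le_r rX]] := IHout tX.
  (* The walk leaves [X] along the edge from [z] to [t]; the excursion from [u] to [t] is replaced
     by nothing or by the two edges through [w]. *)
  have [-> | [w wX [uw wt]]] := detour u t a z aX zX uX tX ua zt.
    by exists r; rewrite /walk tr ry; split=> //; apply: leq_trans le_r (leqW (leqnSn _)).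
  by exists [:: w, t & r]; rewrite /walk /= uw wt tr ry wX tX.
have [r [wr le_r rX]] := (key p x wp).1 xX.
exists r; first by split=> // q /minp; apply: leq_trans le_r.
apply/allP => z; case: r {wr le_r} rX => [//|t r] /= /andP[tX /allP rX].
by move/mem_belast; rewrite inE => /predU1P[->|/rX].
Qed.

End VisibilityCriteria.

(** * The Petersen graph: outer 5-cycle, pentagram and spokes *)

Definition petersen_edges : seq (nat * nat) :=
  [:: (0, 1); (1, 2); (2, 3); (3, 4); (4, 0);
      (5, 7); (7, 9); (9, 6); (6, 8); (8, 5);
      (0, 5); (1, 6); (2, 7); (3, 8); (4, 9)].

Definition petersen_nat (i j : nat) : bool :=
  ((i, j) \in petersen_edges) || ((j, i) \in petersen_edges).

Definition petersen : rel 'I_10 := fun i j => petersen_nat i j.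

Lemma petersen_sym : symmetric petersen.
Proof. by move=> i j; rewrite /petersen /petersen_nat orbC. Qed.

Lemma petersen_irrefl : irreflexive petersen.
Proof.
move=> i; apply/negbTE.
have /allP/(_ i) : all (fun i => ~~ petersen_nat i i) (iota 0 10) by [].
by apply; rewrite mem_iota ltn_ord.
Qed.

(** The girth is 5: an edge between [x] and [y] would close a triangle, a second common neighbor a
    4-cycle. *)
Lemma petersen_girth p x y : petersen p x -> petersen p y -> x != y ->
  ~~ petersen x y /\ forall z, petersen x z -> petersen y z -> z = p.
Proof.
have /allP/(_ p) : all (fun p => all (fun x => all (fun y =>
    [&& petersen_nat p x, petersen_nat p y & x != y] ==>
      ~~ petersen_nat x y && all (fun z =>
        petersen_nat x z && petersen_nat y z ==> (z == p)) (iota 0 10))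
    (iota 0 10)) (iota 0 10)) (iota 0 10) by vm_compute.
have mem (i : 'I_10) : (i : nat) \in iota 0 10 by rewrite mem_iota ltn_ord.
move=> /(_ (mem p)) /allP/(_ x (mem x)) /allP/(_ y (mem y)) /implyP h px py xNy.
have /h/andP[-> /allP{}h] : [&& petersen_nat p x, petersen_nat p y & x != y :> nat].
  exact/and3P.
by split=> // z xz yz; apply/val_inj/eqP; apply: implyP (h z (mem z)) _; apply/andP.
Qed.

Lemma petersen_deg3 p : exists x y z,
  uniq [:: x; y; z] && all (petersen p) [:: x; y; z].
Proof.
have mem (i : 'I_10) : (i : nat) \in iota 0 10 by rewrite mem_iota ltn_ord.
have /allP/(_ p (mem p)) : all (fun p => has (fun x => has (fun y => has (fun z =>
    uniq [:: x; y; z] && all (petersen_nat p) [:: x; y; z])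
    (iota 0 10)) (iota 0 10)) (iota 0 10)) (iota 0 10) by vm_compute.
case/hasP=> x; rewrite mem_iota => x10 /hasP[y]; rewrite mem_iota => y10.
case/hasP=> z; rewrite mem_iota => z10 h.
by exists (Ordinal x10), (Ordinal y10), (Ordinal z10).
Qed.

Lemma petersen_diameter2 (p : 'I_10) : p = ord0 \/ petersen ord0 p \/
  exists2 q, petersen ord0 q & petersen q p.
Proof.
have mem (i : 'I_10) : (i : nat) \in iota 0 10 by rewrite mem_iota ltn_ord.
have /allP/(_ p (mem p)) : all (fun p => [|| p == 0, petersen_nat 0 p |
    has (fun q => petersen_nat 0 q && petersen_nat q p) (iota 0 10)]) (iota 0 10).
  by vm_compute.
case/or3P=> [/eqP p0 | p1 | /hasP[q]]; [by left; apply: val_inj | by right; left | ].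
rewrite mem_iota => q10 /andP[h1 h2].
by right; right; exists (Ordinal q10).
Qed.

(** Serves twice: for the size of a class and for the number of classes of a given size. *)
Lemma card_tag_fibre (I : finType) (T_ : I -> finType) (i : I) :
  #|[set u : {j : I & T_ j} | tag u == i]| = #|T_ i|.
Proof.
have inj_T : injective (@Tagged I i T_).
  by move=> x y /eqP; rewrite eq_Tagged /= => /eqP.
rewrite -(card_imset predT inj_T); apply: eq_card => -[j x]; rewrite inE /=.
apply/eqP/imsetP => [eji | [y _ /(congr1 tag)] //].
by case: _ / eji in inj_T *; exists x.
Qed.

(** * The graph of classes, hubs and links *)

Section ClassGraph.
Variables (U I : finType) (cl : U -> I).

Definition hub : finType := ({set U} * bool)%type.
(* [inl h] is the hub h, and [inr (h, h')] the link between h and h'. *)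
Definition locked : finType := (hub + hub * hub)%type.

Definition one_class (e : {set U}) : bool :=
  [forall a in e, forall b in e, cl a == cl b].

Definition mates (h h' : hub) : bool :=
  [&& h.1 == h'.1, h.2 != h'.2 & ~~ one_class h.1].

(* The link of a pair of mates is only pendant, at its first hub. *)
Definition incident (h : hub) (w : hub * hub) : bool :=
  (h == w.1) || (h == w.2) && ~~ mates w.1 w.2.

Definition locked_adj : rel locked := fun l l' =>
  match l, l' with
  | inl h, inr w | inr w, inl h => incident h w
  | _, _ => false
  end.

(* Each [l : locked] is the vertex [ord0] of its own Petersen graph. *)
Definition gvert : finType := (U + locked * 'I_10)%type.

Definition free_locked_adj (a : U) (lp : locked * 'I_10) : bool :=
  (lp.2 == ord0) && if lp.1 is inl h then a \in h.1 else false.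

Definition gadj : rel gvert := fun x y =>
  match x, y with
  | inl a, inl b => (a != b) && (cl a == cl b)
  | inl a, inr lp | inr lp, inl a => free_locked_adj a lp
  | inr (l, p), inr (l', p') =>
      (l == l') && petersen p p'
      || [&& p == ord0, p' == ord0 & locked_adj l l']
  end.

Lemma gadj_sym : symmetric gadj.
Proof.
case=> [a|[l p]] [b|[l' p']] //=; first by rewrite eq_sym (eq_sym (cl a)).
rewrite eq_sym petersen_sym andbCA; congr (_ || [&& _, _ & _]).
by case: l l' => [h|w] [h'|w'].
Qed.

Lemma gadj_irrefl : irreflexive gadj.
Proof.
case=> [a|[l p]] /=; first by rewrite eqxx.
by rewrite petersen_irrefl !andbF; case: l => [h|w]; rewrite !andbF.
Qed.

Definition class_graph : sgraph := SGraph gadj_sym gadj_irrefl.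
Local Notation G := class_graph.

Definition hub_vert (h : hub) : G := inr (inl h, ord0).
Definition link_vert (w : hub * hub) : G := inr (inr w, ord0).
Definition class_set (i : I) : {set G} := inl @: [set a | cl a == i].

Lemma mates_sym : symmetric mates.
Proof.
by move=> [e b] [e' b']; rewrite /mates /= (eq_sym b); have [->|] := eqVneq e e'.
Qed.

(** * Connectedness and dual sets of the class graph *)

Lemma dual_outside_locked (X : {set G}) l p :
  dual_mutual_visibility X -> inr (l, p) \notin X.
Proof.
have [n1 [n2 [n3 /andP[Un An]]]] := petersen_deg3 p.
pose f q : G := inr (l, q).
have inj_f : injective f by move=> q q' [].
apply: (@dual_outside_3star G X (f p) (f n1) (f n2) (f n3)); last 2 first.
- by rewrite -(map_inj_uniq inj_f) in Un.
- have : all (@adj G (f p)) (map f [:: n1; n2; n3]) by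
    rewrite all_map; apply: sub_all An => q pq; rewrite /= eqxx pq.
  exact.
move=> i j.
rewrite -[[:: _; _; _]]/(map f [:: n1; n2; n3]) => /mapP[x xN ->] /mapP[y yN ->].
rewrite (inj_eq inj_f) => xNy.
have [Nxy uniq_z] := petersen_girth (allP An x xN) (allP An y yN) xNy.
split.
  rewrite /= eqxx (negPf Nxy) /=; case: {+}l => ?; rewrite !andbF //.
(* All edges leaving a Petersen copy start at its vertex [ord0], so two distinct vertices of the
   copy have no common neighbor outside it. *)
case=> [a|[l' z]] /=.
  by case/andP=> /eqP/= x0 _ /andP[/eqP/= y0 _]; rewrite x0 y0 eqxx in xNy.
have [<- /= | _ /=] := eqVneq l l'.
  have loop : locked_adj l l = false by case: {+}l.
  by rewrite loop !andbF !orbF => xz yz; rewrite (uniq_z z).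
by case/and3P=> /eqP x0 _ _ /and3P[/eqP y0 _ _]; rewrite x0 y0 eqxx in xNy.
Qed.

(** Distinct hubs that are not mates use their link. Mates have the same set, which meets several
    classes, so one of its elements lies outside class [i]. *)
Lemma hub_detour i (h h' : hub) : h = h' \/
  exists2 z : G, z \notin class_set i & adj (hub_vert h) z /\ adj z (hub_vert h').
Proof.
have [-> | hNh'] := eqVneq h h'; [by left | right].
have [m | nm] := boolP (mates h h'); last first.
  exists (link_vert (h, h')); first by apply/imsetP => -[].
  by rewrite /= /incident /= !eqxx nm orbT.
have /and3P[/eqP eq_e _] := m.
case/forall_inPn=> a ae /forall_inPn[b be ab].
have [c ce ci] : exists2 c, c \in h.1 & cl c != i.
  by have [ai|] := eqVneq (cl a) i; [exists b; rewrite // -ai eq_sym | exists a].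
exists (inl c); last by rewrite /= /free_locked_adj /= -eq_e ce.
by apply/imsetP => -[d]; rewrite inE => di [cd]; rewrite cd di in ci.
Qed.

Lemma class_graph_connected : connected_graph G.
Proof.
(* The empty set does not meet several classes, so this hub has no mate and is linked to every
   hub. *)
pose r := hub_vert (set0, false).
have to_r x : connect (@adj G) x r.
  have hub_r h : connect (@adj G) (hub_vert h) r.
    have nm : ~~ mates h (set0, false).
      rewrite mates_sym /mates negb_and negbK /=; apply/orP; right.
      by rewrite negb_and negbK; apply/orP; right; apply/forall_inP => a; rewrite inE.
    apply: (@connect_trans _ _ (link_vert (h, (set0, false)))); apply: connect1.
      by rewrite /= /incident /= eqxx.
    by rewrite /= /incident /= eqxx nm orbT.
  case: x => [a|[l p]].
    apply: connect_trans (hub_r ([set a], false)); apply: connect1.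
    by rewrite /= /free_locked_adj /= inE eqxx.
  have sym : connect_sym (@adj G) by apply: sym_connect_sym; apply: gadj_sym.
  have l_r : connect (@adj G) (inr (l, ord0)) r.
    case: l => [h|[h h']]; first exact: hub_r.
    by apply: connect_trans (hub_r h); apply: connect1; rewrite /= /incident eqxx.
  apply: connect_trans l_r; rewrite sym.
  have step q q' : petersen q q' -> connect (@adj G) (inr (l, q)) (inr (l, q')).
    by move=> qq'; apply: connect1; rewrite /= eqxx qq'.
  have [-> | [/step // | [q /step pq /step qp]]] := petersen_diameter2 p.
    exact: connect0.
  exact: connect_trans pq qp.
have sym : connect_sym (@adj G) by apply: sym_connect_sym; apply: gadj_sym.
split; first by apply/card_gt0P; exists r.
by move=> x y; apply: connect_trans (to_r x) _; rewrite sym.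
Qed.

Lemma class_set_dual i : dual_mutual_visibility (class_set i).
Proof.
apply/dual_mutual_visibilityP; split.
  move=> _ _ /imsetP[a + ->] /imsetP[b + ->]; rewrite !inE => /eqP ai /eqP bi.
  have [-> | aNb] := eqVneq a b; first exact: visible_refl.
  by apply: adj_visible; rewrite /= aNb ai bi eqxx.
have boundary (u a : G) : a \in class_set i -> u \notin class_set i -> adj u a ->
    exists h, u = hub_vert h.
  case/imsetP=> b; rewrite inE => bi ->.
  case: u => [c|[[h|w] p]] //= uX; last 2 first.
  - by case/andP=> /eqP/= -> _; exists h.
  - by rewrite /free_locked_adj /= andbF.
  case/andP=> _ cb; case/imsetP: uX; exists c => //.
  by rewrite inE (eqP cb).
move=> x y; rewrite !in_setC => xX yX; apply: detour_visible xX yX _; last first.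
  exact: class_graph_connected.2.
move=> u v a b aX bX uX vX ua bv.
have [h ->] := boundary u a aX uX ua.
have [h' ->] : exists h, v = hub_vert h by apply: (boundary v b) => //; rewrite adj_sym.
by have [->|] := hub_detour i h h'; [left | right].
Qed.

Lemma dual_one_class (X : {set G}) :
  dual_mutual_visibility X -> one_class [set a | inl a \in X].
Proof.
set e := [set a | _]; move=> dX; apply: contraT => bad.
have [_ visCX] := dual_mutual_visibilityP _ dX.
have /forall_inPn[a ae _] := bad.
have blocked : ~ visible X (hub_vert (e, false)) (hub_vert (e, true)).
  apply: (@common_neighbor_blocked G X _ _ (inl a)) => //.
  - by apply/eqP => -[].
  - apply/negP => /orP[/andP[_]|]; last by rewrite !andbF.
    by rewrite petersen_irrefl.
  case=> [b | [[h|[h1 h2]] p]] /=.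
  - by rewrite /free_locked_adj /= inE.
  - rewrite !andbF !orbF => /andP[/eqP h1 _] /andP[/eqP h2 _].
    by rewrite -h2 in h1.
  (* A link adjacent to both hubs would have to be the link of this pair, in one order or the other;
     as they are mates, it misses its second hub. *)
  - have m : mates (e, false) (e, true) by rewrite /mates /= eqxx.
    have m' : mates (e, true) (e, false) by rewrite mates_sym.
    rewrite /incident /= => /andP[_ i1] /andP[_ i2]; move: i1 i2.
    case/predU1P=> [<- | /andP[/eqP <- nm]].
      by case/predU1P=> // /andP[/eqP <-]; rewrite m.
    by case/predU1P=> [h1e | /andP[/eqP //]]; rewrite -h1e m' in nm.
by case: blocked; apply: visCX; rewrite inE dual_outside_locked.
Qed.

(** A hub of [[set a]] is adjacent to no clique vertex but [a], which is therefore its only common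
    neighbor with [b]. *)
Lemma dual_class_closed (X : {set G}) a b :
    dual_mutual_visibility X -> inl a \in X -> cl a = cl b -> inl b \in X.
Proof.
move=> dX aX ab; apply: contraT => bX.
have [_ visCX] := dual_mutual_visibilityP _ dX.
have bNa : b != a by apply: contraNneq bX => ->.
have blocked : ~ visible X (hub_vert ([set a], false)) (inl b).
  apply: (@common_neighbor_blocked G X _ _ (inl a)) => //.
  - by rewrite /= /free_locked_adj /= inE.
  - by rewrite /= /free_locked_adj /= inE eqxx.
  - by rewrite /= eq_sym bNa ab eqxx.
  case=> [c | [[h|w] p]] /=.
  - by rewrite /free_locked_adj /= inE => /eqP ->.
  - case/orP=> [/andP[_ p0] /andP[/eqP/= p1 _]|]; last by rewrite !andbF.
    by rewrite p1 petersen_irrefl in p0.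
  - by rewrite /free_locked_adj /= andbF.
by case: blocked; apply: visCX; rewrite inE ?bX // dual_outside_locked.
Qed.

Lemma dual_class_set (X : {set G}) :
  dual_mutual_visibility X -> X = set0 \/ exists i, X = class_set i.
Proof.
move=> dX; have [-> | [x xX]] := set_0Vmem X; [by left | right].
have lock l p := negP (dual_outside_locked l p dX).
case: x xX => [a aX | [l p] /lock //]; exists (cl a).
apply/setP => -[b | [l p]]; last first.
  by apply/idP/imsetP => [/lock // | [c _]].
apply/idP/imsetP => [bX | [c + [->]]]; last first.
  by rewrite inE => /eqP ca; apply: dual_class_closed aX _.
exists b => //; rewrite inE.
by have /forall_inP/(_ b)/[!inE]/(_ bX)/forall_inP/(_ a)/[!inE]/(_ aX) := dual_one_class dX.
Qed.

End ClassGraph.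

(** * Realization of the prescribed spectrum *)

Theorem theorem4p1 (k : nat) (r : k.+1.-tuple nat)
    (r0 : tnth r ord0 = 1) (rk : 0 < tnth r ord_max) :
  exists G : sgraph,
    [/\ connected_graph G, mu_d G = k
      & tval (dual_visibility_spectrum G) = tval r].
Proof.
(* As r_0 = 1, there is a single class of size 0, which accounts for the empty
   dual set. *)
pose I : finType := {i : 'I_k.+1 & 'I_(tnth r i)}.
pose U : finType := {j : I & 'I_(tag j)}.
pose cl (a : U) : I := tag a.
pose G := class_graph cl.
have card_class (j : I) : #|class_set cl j| = tag j.
  by rewrite card_imset ?card_tag_fibre ?card_ord // => x y [].
pose j0 : I := Tagged (fun i => 'I_(tnth r i)) (cast_ord (esym r0) ord0).
have class0 : class_set cl j0 = set0 by apply/eqP; rewrite -cards_eq0 card_class.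
(* Classes with different indices are disjoint, so only empty ones could coincide, and [j0] is the
   only index of an empty class. *)
have inj_class : injective (class_set cl).
  move=> j j' eq_j; have [j_0 | [x xj]] := set_0Vmem (class_set cl j); last first.
    move: (xj); rewrite eq_j; case/imsetP: xj => a + -> => /[!inE]/eqP <-.
    by case/imsetP=> b + [->] => /[!inE]/eqP.
  have zero (i : I) : class_set cl i = set0 -> i = j0.
    move/eqP; rewrite -cards_eq0 card_class; case: i => i t /= /eqP i0.
    have {}i0 : i = ord0 by apply: val_inj.
    rewrite i0 in t *; congr Tagged; apply: val_inj => /=.
    by apply/eqP; rewrite -leqn0 -ltnS -[X in _ < X]r0.
  by rewrite (zero j j_0) -(zero j') // -eq_j.
have dualE X : dual_mutual_visibility (X : {set G}) = (X \in codom (class_set cl)).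
  apply/idP/codomP => [/dual_class_set[-> | //] | [j ->]]; last exact: class_set_dual.
  by exists j0.
have numE (i : 'I_k.+1) : num_dual_sets G i = tnth r i.
  rewrite -[RHS]card_ord -(card_tag_fibre (fun i => 'I_(tnth r i))).
  rewrite -(card_imset _ inj_class); apply: eq_card => X; rewrite inE dualE.
  apply/andP/imsetP => [[/codomP[j ->]] | [j + ->]].
    by rewrite card_class => ji; exists j; rewrite ?inE.
  by rewrite inE => /eqP ji; rewrite codom_f card_class ji.
have muE : mu_d G = k.
  apply/eqP; rewrite eqn_leq; apply/andP; split.
    apply/bigmax_leqP => X; rewrite dualE => /codomP[j ->].
    by rewrite card_class -ltnS.
  (* As [r_k] is positive, some class has size [k]. *)
  pose jk : I := Tagged (fun i => 'I_(tnth r i)) (Ordinal rk).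
  rewrite -[leqLHS]/(nat_of_ord (tag jk)) -card_class.
  by apply: leq_bigmax_cond; rewrite dualE codom_f.
exists G; split=> //; first exact: class_graph_connected.
apply: (@eq_from_nth _ 0); first by rewrite !size_tuple muE.
rewrite size_tuple => i lt_i; have lt_ik : i < k.+1 by move: lt_i; rewrite muE.
rewrite -(tnth_nth 0 r (Ordinal lt_ik)) -numE.
by rewrite -(tnth_nth 0 (dual_visibility_spectrum G) (Ordinal lt_i)) tnth_mktuple.
Qed.
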